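(* Let $\mathcal{A}$ be a perfect $n$-dimensional evolution algebra over a field $\mathbb{K}$. The Lie algebra $\mathrm{Tder}(\mathcal{A})$ of ternary derivations of $\mathcal{A}$ is isomorphic to $\mathcal{D}_n(\mathbb{K})\times\mathcal{D}_n(\mathbb{K})$.
   Context: $\mathbb{K}$ is an arbitrary field. An $n$-dimensional evolution algebra is an $n$-dimensional vector space $\mathcal{A}$ over $\mathbb{K}$ with a bilinear product admitting a basis $\{e_1,\dots,e_n\}$ (a natural basis) such that $e_ie_j=0$ for $i\neq j$; it is perfect if $\mathcal{A}^2=\mathcal{A}$. A ternary derivation of $\mathcal{A}$ is a triple $(d_1,d_2,d_3)$ of linear maps $\mathcal{A}\to\mathcal{A}$ with $d_1(xy)=d_2(x)y+xd_3(y)$ for all $x,y\in\mathcal{A}$; the set $\mathrm{Tder}(\mathcal{A})$ of these is a Lie algebra under the componentwise Lie bracket (commutator). $\mathcal{D}_n(\mathbb{K})$ denotes the space of diagonal $n\times n$ matrices over $\mathbb{K}$, with the commutator bracket (so it is abelian). *)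

(* Defs.v *)
From HB Require Import structures.
From mathcomp Require Import all_boot all_order all_algebra.
From mathcomp Require Import boolp.

Set Implicit Arguments.
Unset Strict Implicit.
Unset Printing Implicit Defensive.

Import GRing.Theory.
Local Open Scope ring_scope.

HB.mixin Record Lmodule_isLie (K : fieldType) L of GRing.Lmodule K L := {
  lie : L -> L -> L;
  lie_linearl : forall y, linear (fun x => lie x y);
  lie_linearr : forall x, linear (lie x);
  liexx : forall x, lie x x = 0;
  lie_jacobi : forall x y z,
    lie x (lie y z) + lie y (lie z x) + lie z (lie x y) = 0
}.

#[short(type="lieAlgType")]
HB.structure Definition LieAlgebra (K : fieldType) :=
  {L of GRing.Lmodule K L & Lmodule_isLie K L}.

Arguments lie {K s}.

Definition lie_isomorphic (K : fieldType) (L1 L2 : lieAlgType K) : Prop :=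
  exists f : {linear L1 -> L2},
    bijective f /\ forall x y, f (lie x y) = lie (f x) (f y).

(* A Lie algebra structure from an associative bilinear product. It is stated
   for a bare product, as 'End(V) has no ring instance for general V. *)
Section Commutator.

Variables (K : fieldType) (V : lmodType K) (mul : V -> V -> V).
Hypotheses (mulA : associative mul)
  (mull : forall y, linear (mul^~ y)) (mulr : forall x, linear (mul x)).

Definition commutator x y := mul x y - mul y x.

Fact commutator_linearl y : linear (commutator^~ y).
Proof.
move=> a u v; rewrite /commutator (mull y a u v) (mulr y a u v).
by rewrite scalerBr opprD addrACA.
Qed.

Fact commutator_linearr x : linear (commutator x).
Proof.
move=> a u v; rewrite /commutator (mull x a u v) (mulr x a u v).
by rewrite scalerBr opprD addrACA.
Qed.

Fact commutatorxx x : commutator x x = 0.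
Proof. exact: subrr. Qed.

Fact commutator_jacobi x y z :
  commutator x (commutator y z) + commutator y (commutator z x)
    + commutator z (commutator x y) = 0.
Proof.
have mulBl w u v : mul (u - v) w = mul u w - mul v w.
  exact: zmod_morphism_linear (mull w) u v.
have mulBr w u v : mul w (u - v) = mul w u - mul w v.
  exact: zmod_morphism_linear (mulr w) u v.
have subBB (p q r s : V) : p - q - (r - s) = (p + s) - (q + r).
  by rewrite opprB addrACA opprD.
rewrite /commutator !mulBl !mulBr !mulA !subBB.
rewrite [mul (mul y z) x + _]addrC [mul (mul z x) y + _]addrC.
by rewrite [mul (mul z y) x + _]addrC !subrKA subrr.
Qed.

End Commutator.

Section LinearMaps.

Variables (K : fieldType) (V : vectType K).

Fact comp_lfun_linearl (g : 'End(V)) : linear (fun f : 'End(V) => (f \o g)%VF).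
Proof. by move=> a u v; rewrite comp_lfunDl comp_lfunZl. Qed.

Fact comp_lfun_linearr (f : 'End(V)) : linear (fun g : 'End(V) => (f \o g)%VF).
Proof. by move=> a u v; rewrite comp_lfunDr comp_lfunZr. Qed.

HB.instance Definition _ :=
  Lmodule_isLie.Build K 'End(V)
    (commutator_linearl comp_lfun_linearl comp_lfun_linearr)
    (commutator_linearr comp_lfun_linearl comp_lfun_linearr)
    (commutatorxx (@comp_lfun K V V V))
    (commutator_jacobi (@comp_lfunA K V V V V)
       comp_lfun_linearl comp_lfun_linearr).

Lemma lie_lfunE (f g : 'End(V)) : lie f g = ((f \o g) - (g \o f))%VF.
Proof. by []. Qed.

End LinearMaps.

Section Matrices.

Variables (K : fieldType) (n : nat).

Fact mulmx_linearl (B : 'M[K]_n) : linear (fun A : 'M[K]_n => A *m B).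
Proof. by move=> a u v; rewrite mulmxDl scalemxAl. Qed.

Fact mulmx_linearr (A : 'M[K]_n) : linear (fun B : 'M[K]_n => A *m B).
Proof. by move=> a u v; rewrite mulmxDr scalemxAr. Qed.

HB.instance Definition _ :=
  Lmodule_isLie.Build K 'M[K]_n
    (commutator_linearl mulmx_linearl mulmx_linearr)
    (commutator_linearr mulmx_linearl mulmx_linearr)
    (commutatorxx (@mulmx K n n n))
    (commutator_jacobi (@mulmxA K n n n n) mulmx_linearl mulmx_linearr).

Lemma lie_mxE (A B : 'M[K]_n) : lie A B = A *m B - B *m A.
Proof. by []. Qed.

End Matrices.

Section Product.

Variables (K : fieldType) (L1 L2 : lieAlgType K).

Definition lie_pair (x y : L1 * L2) : L1 * L2 := (lie x.1 y.1, lie x.2 y.2).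

Fact lie_pair_linearl y : linear (lie_pair^~ y).
Proof. by move=> a u v; congr (_, _); apply: lie_linearl. Qed.

Fact lie_pair_linearr x : linear (lie_pair x).
Proof. by move=> a u v; congr (_, _); apply: lie_linearr. Qed.

Fact lie_pairxx x : lie_pair x x = 0.
Proof. by congr (_, _); apply: liexx. Qed.

Fact lie_pair_jacobi x y z :
  lie_pair x (lie_pair y z) + lie_pair y (lie_pair z x)
    + lie_pair z (lie_pair x y) = 0.
Proof. by congr (_, _); apply: lie_jacobi. Qed.

HB.instance Definition _ := Lmodule_isLie.Build K (L1 * L2)%type
  lie_pair_linearl lie_pair_linearr lie_pairxx lie_pair_jacobi.

Lemma lie_pairE (x y : L1 * L2) : lie x y = (lie x.1 y.1, lie x.2 y.2).
Proof. by []. Qed.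

End Product.

HB.factory Record SubLmodule_isSubLie (K : fieldType) (L : lieAlgType K)
    (S : pred L) U of @GRing.SubLmodule K L S U := {
  lie_closed_subproof : {in S &, forall x y, lie x y \in S}
}.

HB.builders Context K L S U of SubLmodule_isSubLie K L S U.

Let sub_lie (x y : U) : U :=
  Sub (lie (val x) (val y)) (lie_closed_subproof (valP x) (valP y)).

Let val_sub_lie x y : val (sub_lie x y) = lie (val x) (val y).
Proof. by rewrite SubK. Qed.

Let sub_lie_linearl y : linear (sub_lie^~ y).
Proof.
move=> a u v; apply: val_inj.
rewrite /= linearP val_sub_lie linearP /= !val_sub_lie.
exact: (lie_linearl _ a).
Qed.

Let sub_lie_linearr x : linear (sub_lie x).
Proof.
move=> a u v; apply: val_inj.
rewrite /= linearP val_sub_lie linearP /= !val_sub_lie.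
exact: (lie_linearr _ a).
Qed.

Let sub_liexx x : sub_lie x x = 0.
Proof. by apply: val_inj; rewrite val_sub_lie liexx raddf0. Qed.

Let sub_lie_jacobi x y z :
  sub_lie x (sub_lie y z) + sub_lie y (sub_lie z x)
    + sub_lie z (sub_lie x y) = 0.
Proof.
by apply: val_inj; rewrite !raddfD raddf0 /= !val_sub_lie; apply: lie_jacobi.
Qed.

HB.instance Definition _ := Lmodule_isLie.Build K U
  sub_lie_linearl sub_lie_linearr sub_liexx sub_lie_jacobi.

HB.end.

Section DiagonalMatrices.

Variables (K : fieldType) (n : nat).

Record diagMx := DiagMx {
  diagMx_val :> 'M[K]_n;
  diagMx_valP : is_diag_mx diagMx_val
}.

HB.instance Definition _ := [isSub for diagMx_val].
HB.instance Definition _ := [Choice of diagMx by <:].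

Fact diag_mx_submod_closed :
  submod_closed (fun A : 'M[K]_n => is_diag_mx A).
Proof.
split; first exact: mx0_is_diag.
move=> a A B /is_diag_mxP Ad /is_diag_mxP Bd; apply/is_diag_mxP => i j ij.
by rewrite !mxE Ad // Bd // mulr0 addr0.
Qed.

HB.instance Definition _ :=
  GRing.SubChoice_isSubLmodule.Build K 'M[K]_n _ diagMx
    (GRing.submod_closed_semi diag_mx_submod_closed).

Fact diag_mx_lie_closed :
  {in (fun A : 'M[K]_n => is_diag_mx A) &,
    forall A B, is_diag_mx (lie A B)}.
Proof.
move=> A B /diag_mxP[a ->] /diag_mxP[b ->].
by rewrite lie_mxE diag_mxC subrr mx0_is_diag.
Qed.

HB.instance Definition _ :=
  SubLmodule_isSubLie.Build K 'M[K]_n _ diagMx diag_mx_lie_closed.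

Lemma lie_diagMxE (A B : diagMx) :
  val (lie A B) = val A *m val B - val B *m val A.
Proof. by []. Qed.

End DiagonalMatrices.

Section TernaryDerivations.

Variables (K : fieldType) (A : vectType K) (mul : {bilinear A -> A -> A}).

Definition is_ternary_derivation (d : 'End(A) * 'End(A) * 'End(A)) : Prop :=
  let: (d1, d2, d3) := d in
  forall x y, d1 (mul x y) = mul (d2 x) y + mul x (d3 y).

Definition tder_pred : pred ('End(A) * 'End(A) * 'End(A)) :=
  fun d => `[< is_ternary_derivation d >].

Record Tder := MkTder {
  tder_val :> 'End(A) * 'End(A) * 'End(A);
  tder_valP : tder_pred tder_val
}.

HB.instance Definition _ := [isSub for tder_val].
HB.instance Definition _ := [Choice of Tder by <:].

Fact tder_submod_closed : submod_closed tder_pred.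
Proof.
split; first by apply/asboolP => x y; rewrite !lfunE /= linear0l linear0r addr0.
move=> a [[d1 d2] d3] [[d1' d2'] d3'] /asboolP dP /asboolP dP'.
apply/asboolP => x y.
by rewrite !lfunE /= !lfunE /= dP dP' linearPl linearPr scalerDr addrACA.
Qed.

HB.instance Definition _ :=
  GRing.SubChoice_isSubLmodule.Build K _ _ Tder
    (GRing.submod_closed_semi tder_submod_closed).

Fact tder_lie_closed : {in tder_pred &, forall d d', lie d d' \in tder_pred}.
Proof.
move=> [[d1 d2] d3] [[d1' d2'] d3'] /asboolP dP /asboolP dP'.
apply/asboolP; rewrite !lie_pairE !lie_lfunE /= => x y.
rewrite !lfun_simp linearBl linearBr /= dP dP' !linearD /= !dP !dP'.
have cancel (a b c e f g : A) :
    a + b + (c + e) + (- (f + c) - (b + g)) = a - f + (e - g).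
  rewrite [a + b + _]addrACA [LHS]addrACA [f + c]addrC.
  by rewrite addrKA [b + e]addrC addrKA.
by rewrite cancel.
Qed.

HB.instance Definition _ := SubLmodule_isSubLie.Build K _ _ Tder tder_lie_closed.

Lemma lie_TderE (d d' : Tder) : val (lie d d') = lie (val d) (val d').
Proof. by []. Qed.

End TernaryDerivations.

Section EvolutionAlgebras.

Variables (K : fieldType) (A : vectType K) (mul : {bilinear A -> A -> A}).

Definition natural_basis n (e : n.-tuple A) : Prop :=
  basis_of fullv e /\ forall i j : 'I_n, i != j -> mul (tnth e i) (tnth e j) = 0.

Definition evolution_algebra n : Prop :=
  \dim {:A} = n /\ exists e : n.-tuple A, natural_basis e.

(* A^2, the span of all products, not only of those of basis vectors: see
   square_subvP. *)
Definition square : {vspace A} :=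
  <<[seq mul x y | x <- vbasis {:A}, y <- vbasis {:A}]>>%VS.

Definition perfect : Prop := square = {:A}%VS.

Lemma mul_square x y : mul x y \in square.
Proof.
rewrite (coord_vbasis (memvf x)) (coord_vbasis (memvf y)).
rewrite linear_sumlz; apply: rpred_sum => i _.
rewrite linear_sumr; apply: rpred_sum => j _.
rewrite linearZl_LR linearZr_LR !rpredZ // memv_span //.
by apply: allpairs_f; apply: mem_nth; rewrite size_tuple.
Qed.

Lemma square_subvP (W : {vspace A}) :
  (forall x y, mul x y \in W) <-> (square <= W)%VS.
Proof.
split=> [mulW | /subvP sW x y]; last exact/sW/mul_square.
by apply/span_subvP => _ /allpairsP[[x y] /= [_ _ ->]].
Qed.

End EvolutionAlgebras.

(* Main.v *)
Require Import Defs.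
From HB Require Import structures.
From mathcomp Require Import all_boot all_order all_algebra.
From mathcomp Require Import boolp.
Set Implicit Arguments.
Unset Strict Implicit.
Unset Printing Implicit Defensive.
Import GRing.Theory.
Local Open Scope ring_scope.

(** Let [e] be a natural basis. Since [A] is perfect, the squares
    [u_i = e_i e_i] span [A] and hence form a basis too
    ([square_tuple_basis]). For [i != j], applying a ternary derivation
    [(d1, d2, d3)] to [e_i e_j = 0] gives
      [0 = d2(e_i) e_j + e_i d3(e_j) = coord_j(d2 e_i) u_j + coord_i(d3 e_j) u_i]
    so both coordinates vanish: [d2] and [d3] are diagonal in the basis [e].
    Applying it to [e_i e_i = u_i] then shows that [d1] is diagonal in the
    basis [u], with eigenvalues the sums of those of [d2] and [d3]
    ([tder_diag]). Conversely every pair of diagonal maps arises in this way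
    ([diag_tder]), so reading off the eigenvalues of [d2] and [d3] is a linear
    bijection onto pairs of diagonal matrices. It respects brackets because
    diagonal maps, like diagonal matrices, commute. *)

Section DiagonalMaps.

Variables (K : fieldType) (A : vectType K) (n : nat) (X : n.-tuple A).

Definition diag_lfun (c : 'I_n -> K) : 'End(A) :=
  linfun (fun x => \sum_i c i *: (coord X i x *: tnth X i)).

Lemma diag_lfunE c x :
  diag_lfun c x = \sum_i c i *: (coord X i x *: tnth X i).
Proof.
pose F x := \sum_i c i *: (coord X i x *: tnth X i).
have F_linear : linear F.
  move=> a y z; rewrite /F scaler_sumr -big_split; apply: eq_bigr => i _ /=.
  by rewrite linearP scalerDl scalerDr !scalerA mulrCA mulrA.
exact: (lfunE (HB.pack F (GRing.isLinear.Build K A A _ F F_linear))).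
Qed.

(** Off-diagonal entries are discarded rather than required to vanish: this
    makes the map linear on all of [End(A)], for any tuple [X], so that it can
    be inverted later on diagonal maps only. *)
Definition diag_part (f : 'End(A)) : diagMx K n :=
  DiagMx (diag_mx_is_diag (\row_i coord X i (f (tnth X i)))).

Lemma diag_partE f i : diag_part f i i = coord X i (f (tnth X i)).
Proof. by rewrite !mxE eqxx. Qed.

Fact diag_part_linear : linear diag_part.
Proof.
move=> a f g; apply: val_inj => /=; apply/matrixP => i j.
by rewrite !mxE !lfunE /= !lfunE /= linearP mulrnDl mulrnAr.
Qed.

HB.instance Definition _ :=
  GRing.isLinear.Build K 'End(A) (diagMx K n) _ diag_part diag_part_linear.

Hypothesis X_basis : basis_of fullv X.

Lemma coord_basis_sum x : x = \sum_i coord X i x *: tnth X i.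
Proof.
rewrite {1}(coord_basis X_basis (memvf x)).
by apply: eq_bigr => i _; rewrite (tnth_nth 0).
Qed.

Lemma coord_tnth i j : coord X i (tnth X j) = (i == j)%:R.
Proof. by rewrite (tnth_nth 0) coord_free ?(basis_free X_basis) // eq_sym. Qed.

Lemma eq_lfun_basis (f g : 'End(A)) :
  (forall i, f (tnth X i) = g (tnth X i)) -> f = g.
Proof.
move=> fg; apply/lfunP => x; rewrite (coord_basis_sum x) !linear_sum.
by apply: eq_bigr => i _; rewrite !linearZ /= fg.
Qed.

Lemma diag_lfun_tnth c i : diag_lfun c (tnth X i) = c i *: tnth X i.
Proof.
rewrite diag_lfunE (bigD1 i) //= coord_tnth eqxx scale1r big1 ?addr0 // => j ji.
by rewrite coord_tnth (negPf ji) scale0r scaler0.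
Qed.

Lemma coord_diag_lfun c i x : coord X i (diag_lfun c x) = c i * coord X i x.
Proof.
rewrite diag_lfunE linear_sum (bigD1 i) //= big1 => [|j ji].
  by rewrite !linearZ /= coord_tnth eqxx mulr1 addr0.
by rewrite !linearZ /= coord_tnth eq_sym (negPf ji) !mulr0.
Qed.

Lemma diag_lfun_comm c c' :
  (diag_lfun c \o diag_lfun c' = diag_lfun c' \o diag_lfun c)%VF.
Proof.
apply: eq_lfun_basis => i.
by rewrite !comp_lfunE !diag_lfun_tnth !linearZ /= !diag_lfun_tnth !scalerA mulrC.
Qed.

Lemma diag_part_diag_lfun (D : diagMx K n) :
  diag_part (diag_lfun (fun i => D i i)) = D.
Proof.
apply: val_inj => /=; apply/matrixP => i j; rewrite !mxE.
have [<-|ij] := eqVneq i j; last first.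
  by rewrite mulr0n (is_diag_mxP (diagMx_valP D)).
by rewrite coord_diag_lfun coord_tnth eqxx mulr1.
Qed.

End DiagonalMaps.

Lemma lie_diagMx_eq0 (K : fieldType) n (D D' : diagMx K n) : lie D D' = 0.
Proof.
apply: val_inj; rewrite lie_diagMxE linear0.
case/diag_mxP: (diagMx_valP D) => d /= ->.
by case/diag_mxP: (diagMx_valP D') => d' /= ->; rewrite diag_mxC subrr.
Qed.

Section NaturalBasis.

Variables (K : fieldType) (A : vectType K) (mul : {bilinear A -> A -> A}).
Variables (n : nat) (e : n.-tuple A).
Hypothesis e_nat : natural_basis mul e.

Let e_basis : basis_of fullv e := e_nat.1.

Definition square_tuple : n.-tuple A := [tuple mul (tnth e i) (tnth e i) | i < n].

Local Notation u := square_tuple.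

Lemma mul_tnthr x j : mul x (tnth e j) = coord e j x *: tnth u j.
Proof.
rewrite {1}(coord_basis_sum e_basis x) linear_sumlz (bigD1 j) //= big1.
  by rewrite linearZl_LR tnth_mktuple addr0.
by move=> i ij; rewrite linearZl_LR e_nat.2 ?scaler0.
Qed.

Lemma mul_tnthl i y : mul (tnth e i) y = coord e i y *: tnth u i.
Proof.
rewrite {1}(coord_basis_sum e_basis y) linear_sumr (bigD1 i) //= big1.
  by rewrite linearZr_LR tnth_mktuple addr0.
by move=> j ji; rewrite linearZr_LR e_nat.2 ?scaler0 // eq_sym.
Qed.

Lemma mul_coordE x y :
  mul x y = \sum_i (coord e i x * coord e i y) *: tnth u i.
Proof.
rewrite {1}(coord_basis_sum e_basis x) linear_sumlz; apply: eq_bigr => i _.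
by rewrite linearZl_LR mul_tnthl scalerA.
Qed.

(** All products lie in the span of the [n] squares, so perfection makes that
    span the whole [n]-dimensional space. *)
Lemma square_tuple_basis : perfect mul -> basis_of fullv u.
Proof.
move=> hperf; rewrite basisEdim; apply/andP; split; last first.
  by rewrite size_tuple -(size_basis e_basis).
rewrite -hperf; apply/square_subvP => x y; rewrite mul_coordE.
by apply: rpred_sum => i _; rewrite rpredZ // memv_span // mem_tnth.
Qed.

Hypothesis u_basis : basis_of fullv u.

(** The [i]-th coordinate of a product along the squares is the product of the
    [i]-th coordinates of the factors along [e], so scaling the [i]-th coordinate of either factor scales the [u_i] component of the
    product; this is the Leibniz rule with [d1] diagonal along the squares. *)
Lemma diag_tder (a b : 'I_n -> K) :
  is_ternary_derivation mul
    (diag_lfun u (fun i => a i + b i), diag_lfun e a, diag_lfun e b).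
Proof.
move=> x y; rewrite !mul_coordE linear_sum -big_split; apply: eq_bigr => i _ /=.
rewrite linearZ /= (diag_lfun_tnth u_basis) !(coord_diag_lfun e_basis).
by rewrite scalerA -scalerDl mulrC mulrDl mulrA mulrCA.
Qed.

(** The image of [e_i e_j = 0] is a relation between the two distinct squares
    [u_i] and [u_j], which are independent. *)
Lemma tder_offdiag d1 d2 d3 i j : is_ternary_derivation mul (d1, d2, d3) ->
  i != j -> coord e j (d2 (tnth e i)) = 0 /\ coord e i (d3 (tnth e j)) = 0.
Proof.
move=> dP ij; have := dP (tnth e i) (tnth e j).
rewrite e_nat.2 // linear0 mul_tnthr mul_tnthl => /esym uij0.
have coordE k := congr1 (coord u k) uij0.
move: (coordE j) (coordE i).
rewrite !linearD !linearZ /= !(coord_tnth u_basis) !eqxx linear0 linear0.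
by rewrite (negPf ij) eq_sym (negPf ij) !mulr1 !mulr0 addr0 add0r.
Qed.

Lemma diag_lfun_offdiag (f : 'End(A)) :
    (forall i j, i != j -> coord e j (f (tnth e i)) = 0) ->
  f = diag_lfun e (fun i => diag_part e f i i).
Proof.
move=> f0; apply: (eq_lfun_basis e_basis) => i.
rewrite (diag_lfun_tnth e_basis) diag_partE.
rewrite {1}(coord_basis_sum e_basis (f _)) (bigD1 i) //= big1 ?addr0 // => j ji.
by rewrite f0 ?scale0r // eq_sym.
Qed.

(** For [d1] the relation used is the image of [e_i e_i = u_i]; it determines
    [d1] because the squares span, so a ternary derivation carries no more data
    than the eigenvalues of its last two components. *)
Lemma tder_diag d1 d2 d3 (a := fun i => diag_part e d2 i i)
    (b := fun i => diag_part e d3 i i) :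
    is_ternary_derivation mul (d1, d2, d3) ->
  [/\ d1 = diag_lfun u (fun i => a i + b i), d2 = diag_lfun e a
    & d3 = diag_lfun e b].
Proof.
move=> dP; split.
- apply: (eq_lfun_basis u_basis) => i; rewrite (diag_lfun_tnth u_basis).
  rewrite {1}tnth_mktuple dP mul_tnthr mul_tnthl -scalerDl.
  by rewrite /a /b !diag_partE.
- by apply: diag_lfun_offdiag => i j /(tder_offdiag dP)[].
- apply: diag_lfun_offdiag => i j; rewrite eq_sym.
  by case/(tder_offdiag dP).
Qed.

Definition tder_of_diag (D : diagMx K n * diagMx K n) : Tder mul :=
  MkTder (asboolT (diag_tder (fun i => D.1 i i) (fun i => D.2 i i))).

End NaturalBasis.

Section DiagonalParts.

Variables (K : fieldType) (A : vectType K) (mul : {bilinear A -> A -> A}).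
Variables (n : nat) (e : n.-tuple A).

Definition tder_diag_parts (d : Tder mul) : diagMx K n * diagMx K n :=
  (diag_part e (val d).1.2, diag_part e (val d).2).

Fact tder_diag_parts_linear : linear tder_diag_parts.
Proof. by move=> c d d'; congr (_, _); apply: diag_part_linear. Qed.

HB.instance Definition _ := GRing.isLinear.Build K (Tder mul)
  (diagMx K n * diagMx K n)%type _ tder_diag_parts tder_diag_parts_linear.

End DiagonalParts.

Theorem corollary3p8 (K : fieldType) (n : nat) (A : vectType K)
    (mul : {bilinear A -> A -> A})
    (hA : evolution_algebra mul n) (hperf : perfect mul) :
  lie_isomorphic (Tder mul) (diagMx K n * diagMx K n)%type.
Proof.
have [_ [e e_nat]] := hA.
have e_basis := e_nat.1; have u_basis := square_tuple_basis e_nat hperf.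
exists (@tder_diag_parts K A mul n e); split.
  exists (tder_of_diag e_nat u_basis) => [[[[d1 d2] d3] dP]|[D D']].
    apply: val_inj => /=.
    by have [<- <- <-] := tder_diag e_nat u_basis (asboolW dP).
  by congr (_, _); apply: diag_part_diag_lfun.
move=> [[[d1 d2] d3] dP] [[[d1' d2'] d3'] dP'].
have [_ d2E d3E] := tder_diag e_nat u_basis (asboolW dP).
have [_ d2'E d3'E] := tder_diag e_nat u_basis (asboolW dP').
(* The target is abelian, so the images of the commutators must vanish. *)
rewrite lie_pairE !lie_diagMx_eq0 /= /tder_diag_parts lie_TderE !lie_pairE /=.
rewrite !lie_lfunE d2E d3E d2'E d3'E.
by congr (_, _); rewrite diag_lfun_comm // subrr linear0.
Qed.
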